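(* Let $\mathbb{S}^1=\mathbb{R}/\mathbb{Z}$ and fix $(c,e)\in\mathbb{S}^1\times\mathbb{S}^1\cong\mathbb{T}^2$, $\varphi\in\mathbb{S}^1$ and $\varepsilon>0$. Then for all but finitely many $\vartheta\in\mathbb{S}^1$ and for all $d\in\mathbb{S}^1$ there exists an $n$ such that $$R^n_{\varphi,\vartheta}(c,d)\in(c-\varepsilon,c+\varepsilon)\times(e-\varepsilon,e+\varepsilon).$$
   Context: $R_{\varphi,\vartheta}:\mathbb{T}^2\to\mathbb{T}^2$ denotes the rotation $(x,y)\mapsto(x+\varphi,y+\vartheta)$, and $R^n_{\varphi,\vartheta}$ its $n$-th iterate, so $R^n_{\varphi,\vartheta}(c,d)=(c+n\varphi,d+n\vartheta)$. *)

(* Defs.v *)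
From HB Require Import structures.
From mathcomp Require Import all_boot all_order all_algebra.
From mathcomp Require Import generic_quotient ring_quotient.
From mathcomp Require Import boolp classical_sets functions cardinality.
From mathcomp Require Import set_interval reals.

Set Implicit Arguments.
Unset Strict Implicit.
Unset Printing Implicit Defensive.

Import Order.TTheory GRing.Theory Num.Theory.

Local Open Scope quotient_scope.
Local Open Scope classical_set_scope.
Local Open Scope ring_scope.

(* [Num.int_num_subdef] is the predicate underlying [Num.int], the form under
   which the integers carry the subgroup instance needed by [Quotient.quot]. *)
Definition circle (R : realType) : Type :=
  Quotient.quot (Num.int_num_subdef : {pred R}).

HB.instance Definition _ (R : realType) := Choice.on (circle R).
HB.instance Definition _ (R : realType) := GRing.Zmodule.on (circle R).

Definition circle_pi (R : realType) (x : R) : circle R :=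
  \pi_(Quotient.quot (Num.int_num_subdef : {pred R})) x.

Lemma circle_piD (R : realType) (x y : R) :
  circle_pi (x + y) = circle_pi x + circle_pi y.
Proof. exact: pi_addr. Qed.

Lemma circle_pi_surj (R : realType) (u : circle R) :
  exists x : R, circle_pi x = u.
Proof. by exists (repr u); apply: reprK. Qed.

Lemma eq_circle_pi (R : realType) (x y : R) :
  circle_pi x = circle_pi y <-> exists m : int, x - y = m%:~R.
Proof.
have piE : (circle_pi x == circle_pi y) = (x - y \is a Num.int).
  by rewrite unfold_in; symmetry; apply: Quotient.idealrBE.
by split=> [/eqP|xy]; [rewrite piE => /intrP|apply/eqP; rewrite piE; apply/intrP].
Qed.

(* (u - eps, u + eps) in R / Z: the image of the real interval of that form
   centred at any lift of u, see [circle_arc_pi]; for eps > 1/2 it is the whole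
   circle. *)
Definition circle_arc (R : realType) (u : circle R) (eps : R) : set (circle R) :=
  [set u + circle_pi t | t in `](- eps), eps[ ].

Lemma circle_arc_pi (R : realType) (x eps : R) :
  circle_arc (circle_pi x) eps = @circle_pi R @` `](x - eps), (x + eps)[.
Proof.
apply/seteqP; split=> _ [t + <-]; rewrite /= in_itv /= => /andP[t1 t2].
  exists (x + t); last exact: circle_piD.
  by rewrite /= in_itv /= !ltrD2l t1.
exists (t - x); last by rewrite -circle_piD subrKC.
by rewrite /= in_itv /= ltrBDr ltrBlDr addrC t1 addrC.
Qed.

Definition rotation (R : realType) (phi theta : circle R)
    (p : circle R * circle R) : circle R * circle R :=
  (p.1 + phi, p.2 + theta).

(* Main.v *)
From HB Require Import structures.
Require Import Defs.
From mathcomp Require Import all_boot all_order all_algebra.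
From mathcomp Require Import boolp classical_sets functions cardinality reals.
From mathcomp Require Import lra ring.

Import Order.TTheory GRing.Theory Num.Theory.

Local Open Scope classical_set_scope.
Local Open Scope ring_scope.

(** The exceptional [theta] are resonances: they satisfy [b theta = a phi] in the
circle for some [b > 0] and [a] whose sizes are bounded in terms of [eps] alone.
Multiplication by [b] is finite-to-one on the circle, so only finitely many
[theta] are resonant ([finite_resonances]). What has to be shown is that, in the
absence of such a relation, the times [n] with [n phi] close to [0] already make
[n theta] visit every arc of length [2 eps] ([resonance_or_dense_orbit]).

Fix a large [M]. Dirichlet's simultaneous approximation, by pigeonhole on the
[M ^ 2] cells of the torus, gives a time [1 <= n <= M ^ 2] at which the orbit of
[0] returns to a point [(x, y)] of the plane with [|x|, |y| < 1 / M]. The bound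
on [n] depends on [M] only. The times [k n] follow the ray spanned by [(x, y)]
in steps shorter than [1 / M].
- If the ray is steep, [|x| <= eps / 2 * |y|], and [y] is not [0], then the ray
  crosses the whole second circle before its first coordinate leaves
  [(-eps, eps)].
- If [x = y = 0], then [n theta = 0], a resonance.
- If the ray is shallow, its slope [s = y / |x|] satisfies [|s| < 2 / eps]. Each
  time the ray winds around the first circle, the second coordinate moves by
  [s], so the multiples of [s] modulo [1] can be approached. Either they are
  [eps / 2]-dense, or [b s] is an integer [a] for some [b <= M]. In the latter
  case [b y = a |x|], that is [b n theta = +- a n phi], a resonance whose
  coefficients are bounded because [b], [n] and [s] are. *)

(** * Diophantine approximation *)

(** Pigeonhole: cut the unit cube into [M ^ #|I|] cells; two of the points
[k * f] modulo [1] with [0 <= k <= M ^ #|I|] share a cell. *)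
Lemma simultaneous_dirichlet {R : realType} {I : finType} (f : I -> R)
    {M : nat} : (0 < M)%N ->
  exists2 n : nat, (0 < n <= M ^ #|I|)%N &
    forall i, exists p : int, `|n%:R * f i - p%:~R| < M%:R^-1.
Proof.
move=> M0; have MR0 : (0 : R) < M%:R by rewrite ltr0n.
pose fl k i := Num.floor (k%:R * f i) : int.
pose fr k i := k%:R * f i - (fl k i)%:~R.
have frP k i : 0 <= fr k i < 1.
  by have /andP[] := floor_itv (k%:R * f i); rewrite /fr /fl intrD; lra.
have cellP k i : (Num.truncn (M%:R * fr k i))%:R <= M%:R * fr k i
                 < (Num.truncn (M%:R * fr k i))%:R + 1.
  have /andP[fr0 _] := frP k i.
  by rewrite natr1; apply: truncn_itv; rewrite mulr_ge0 // ltW.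
have cell_lt k i : (Num.truncn (M%:R * fr k i) < M)%N.
  have /andP[fr0 fr1] := frP k i; have /andP[c0 _] := cellP k i.
  by rewrite -(ltr_nat R); apply: le_lt_trans c0 _; rewrite gtr_pMr.
pose cell (k : 'I_(M ^ #|I|).+1) := [ffun i => Ordinal (cell_lt k i)].
have [k [l [kl ckl]]] : exists k l : 'I__, (k < l)%N /\ cell k = cell l.
  have /injectivePn[k [l kl ckl]] : ~~ injectiveb cell.
    apply/negP => /injectiveP/leq_card.
    by rewrite card_ffun !card_ord ltnn.
  have [kl'|lk|/val_inj kl'] := ltngtP k l; [by exists k, l|by exists l, k|].
  by rewrite kl' eqxx in kl.
exists (l - k)%N => [|i].
  by rewrite subn_gt0 kl (leq_trans (leq_subr _ _)) // -ltnS.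
exists (fl l i - fl k i).
have /(congr1 (fun g : {ffun I -> 'I_M} => val (g i))) := ckl.
rewrite !ffunE /= => ckli.
have /andP[] := cellP k i; have /andP[] := cellP l i; rewrite ckli => l0 l1 k0 k1.
rewrite natrB 1?ltnW // intrB.
have -> : (l%:R - k%:R) * f i - ((fl l i)%:~R - (fl k i)%:~R) = fr l i - fr k i.
  by rewrite /fr; ring.
rewrite -(ltr_pM2l MR0) divff ?gt_eqF // -{1}(gtr0_norm MR0) -normrM mulrBr.
by rewrite ltr_norml; lra.
Qed.

(** The witness is the integer part of [t / r]; the sign condition makes it a
natural number, as only forward times are allowed. *)
Lemma ray_step {R : realType} {r t : R} : r != 0 -> 0 <= t * r ->
  exists k : nat, `|k%:R * r - t| < `|r|.
Proof.
move=> r0 tr; have q0 : 0 <= t / r.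
  have -> : t / r = t * r / r ^+ 2 by field.
  by rewrite divr_ge0 ?sqr_ge0.
exists (Num.truncn (t / r)); have := truncn_itv q0; rewrite -natr1.
set k := _%:R => /andP[k0 k1].
have -> : k * r - t = (k - t / r) * r by field.
by rewrite normrM gtr_pMl ?normr_gt0 // ltr_norml; lra.
Qed.

(** The multiples of [r] move in one direction only, but modulo [1] the target
[t] has a representative on that side. The bound on it limits how long the walk
takes, hence how far a steep ray drifts sideways. *)
Lemma ray_step_mod1 {R : realType} {r : R} (t : R) : r != 0 ->
  exists (k : nat) (m : int),
    `|k%:R * r - (t + m%:~R)| < `|r| /\ `|t + m%:~R| <= 1.
Proof.
move=> r0; have /andP[] := floor_itv t; rewrite intrD => t0 t1.
have [m tmr tm] : exists2 m : int, 0 <= (t + m%:~R) * r & `|t + m%:~R| <= 1.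
  have [rpos|rneg] := leP 0 r.
    exists (- Num.floor t); rewrite intrN; first by rewrite mulr_ge0 //; lra.
    by rewrite ler_norml; lra.
  exists (- Num.floor t - 1); rewrite intrB intrN.
    by rewrite mulr_le0 ?(ltW rneg) //; lra.
  by rewrite ler_norml; lra.
by have [k kr] := ray_step r0 tmr; exists k, m.
Qed.

(** Some [b <= M] brings [b * s] within [1 / M] of an integer. If the distance is
not zero, its multiples walk around the circle in steps shorter than [del]. *)
Lemma multiples_dense_or_torsion {R : realType} (s : R) {del : R} {M : nat} :
    (0 < M)%N -> M%:R^-1 < del ->
  (exists (b : nat) (a : int), (0 < b <= M)%N /\ b%:R * s = a%:~R) \/
  (forall t : R, exists (j : nat) (m : int), `|j%:R * s - (t + m%:~R)| < del).
Proof.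
move=> M0 Mdel.
have [b] := simultaneous_dirichlet (fun _ : unit => s) M0.
rewrite card_unit expn1 => bM /(_ tt)[p bsp].
have [/eqP|r0] := eqVneq (b%:R * s - p%:~R) 0.
  by rewrite subr_eq0 => /eqP bs; left; exists b, p.
right => t; have [k [m [km _]]] := ray_step_mod1 t r0.
exists (k * b)%N, (m + k%:Z * p).
rewrite intrD intrM natrM -pmulrn.
have -> : k%:R * b%:R * s - (t + (m%:~R + k%:R * p%:~R)) =
          k%:R * (b%:R * s - p%:~R) - (t + m%:~R) by ring.
exact: lt_trans km (lt_trans bsp Mdel).
Qed.

(** * Steep and shallow returns to the origin *)

(** The disjunction is obtained from a single short return vector [(x, y)]
of the orbit. The bounds on [a] and [b] do not mention [t], which is what makes
the set of resonances finite. *)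
Lemma resonance_or_dense_orbit {R : realType} (f t : R) {eps : R} {M : nat} :
    (0 < M)%N -> M%:R^-1 < eps / 2 ->
  (exists (b : nat) (a m : int), [/\ (0 < b <= M ^ 3)%N,
      `|a%:~R| <= (M ^ 3)%:R * (2 / eps) & b%:R * t = a%:~R * f + m%:~R]) \/
  (forall g : R, exists (k : nat) (p q : int),
      `|k%:R * f - p%:~R| < eps /\ `|k%:R * t - (g + q%:~R)| < eps).
Proof.
move=> M0 Meps; have MR0 : (0 : R) < M%:R^-1 by rewrite invr_gt0 ltr0n.
have M1 : (M%:R^-1 : R) <= 1 by rewrite invf_le1 ?ltr0n // ler1n.
have eps0 : 0 < eps by lra.
have [n] := simultaneous_dirichlet (fun b : bool => if b then t else f) M0.
rewrite card_bool => /andP[n0 nM] near0.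
have [p] := near0 false; have [q] := near0 true; rewrite /= {near0}.
set y := n%:R * t - q%:~R; set x := n%:R * f - p%:~R => yM xM.
(* Steep ray: sweep the second coordinate directly, over a length at most [1]. *)
have [xy|xy] := leP `|x| (eps / 2 * `|y|).
  have [/eqP|y0] := eqVneq y 0.
    rewrite subr_eq0 => /eqP nt; left; exists n, 0, q; split.
    - by rewrite n0 (leq_trans nM) // leq_pexp2l.
    - by rewrite normr0 mulr_ge0 // divr_ge0 // ltW.
    - by rewrite mul0r add0r.
  right => g; have [k [m [km g1]]] := ray_step_mod1 g y0.
  exists (k * n)%N, (k%:Z * p), (m + k%:Z * q).
  rewrite intrD !intrM natrM -!pmulrn; split.
    have -> : k%:R * n%:R * f - k%:R * p%:~R = k%:R * x by rewrite /x; ring.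
    have ky : `|k%:R * y| < 2.
      have := ler_normD (k%:R * y - (g + m%:~R)) (g + m%:~R).
      by rewrite subrK; lra.
    rewrite normrM in ky; rewrite normrM.
    apply: le_lt_trans (ler_wpM2l (normr_ge0 _) xy) _; rewrite mulrCA.
    by move: ky; rewrite -(@ltr_pM2l _ (eps / 2)) ?divr_gt0 //; lra.
  have -> : k%:R * n%:R * t - (g + (m%:~R + k%:R * q%:~R)) =
            k%:R * y - (g + m%:~R) by rewrite /y; ring.
  lra.
(* Shallow ray, followed in the direction of the sign [sg] of [x]. *)
have x0 : 0 < `|x| by apply: le_lt_trans xy; rewrite mulr_ge0 // divr_ge0 // ltW.
have xn0 : x != 0 by rewrite -normr_gt0.
have slope : `|y / `|x| | < 2 / eps.
  rewrite normrM normfV normr_id ltr_pdivrMr // mulrAC ltr_pdivlMr //; lra.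
have [sg [xsg absx sg1]] : exists sg : int,
    [/\ x = sg%:~R * `|x|, `|x| = sg%:~R * x & `|sg%:~R : R| = 1].
  have [x_ge0|x_lt0] := leP 0 x.
    by exists 1; rewrite mulr1z !mul1r normr1 ger0_norm.
  by exists (- 1); rewrite intrN mulr1z !mulN1r normrN normr1 ltr0_norm // opprK.
have [[b [a [/andP[b0 bM] bya]]]|dense] := multiples_dense_or_torsion (y / `|x|) M0 Meps.
  left; exists (b * n)%N, (a * sg * n), (b%:Z * q - a * sg * p); split.
  - by rewrite muln_gt0 b0 n0 expnS leq_mul.
  - rewrite !intrM -bya -pmulrn 2!normrM sg1 mulr1 normrM !normr_nat mulrAC -natrM.
    by rewrite ler_pM ?(ltW slope) // ler_nat expnS leq_mul.
  - rewrite intrB !intrM natrM -!pmulrn.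
    have : b%:R * y = a%:~R * sg%:~R * x.
      by rewrite -mulrA -absx -bya -mulrA divfK // gt_eqF.
    by rewrite /x /y; lra.
(* [j] full turns in the first coordinate put the ray within [eps / 2] of [g] in
   the second; the [k]-th step along the ray is within one step of that place. *)
right => g; have [j [m jm]] := dense g.
have [k kj] : exists k : nat, `|k%:R * `|x| - j%:R| < `|x|.
  have [||k] := @ray_step _ `|x| j%:R; rewrite ?gt_eqF ?mulr_ge0 //.
  by rewrite normr_id; exists k.
exists (k * n)%N, (k%:Z * p + j%:Z * sg), (m + k%:Z * q).
rewrite !intrD !intrM natrM -!pmulrn; split.
  have -> : k%:R * n%:R * f - (k%:R * p%:~R + j%:R * sg%:~R) =
            sg%:~R * (k%:R * `|x| - j%:R).
    by rewrite mulrBr mulrCA -xsg /x; ring.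
  by rewrite normrM sg1 mul1r; lra.
have -> : k%:R * n%:R * t - (g + (m%:~R + k%:R * q%:~R)) =
    y / `|x| * (k%:R * `|x| - j%:R) + (j%:R * (y / `|x|) - (g + m%:~R)).
  have -> : y / `|x| * (k%:R * `|x| - j%:R) = k%:R * y - j%:R * (y / `|x|).
    by field; rewrite gt_eqF.
  by rewrite /y; ring.
apply: le_lt_trans (ler_normD _ _) _.
have : `|y / `|x| * (k%:R * `|x| - j%:R)| <= `|y|.
  rewrite normrM -[leRHS](@divfK _ `|x|) ?gt_eqF // normrM normfV normr_id.
  by rewrite ler_wpM2l ?divr_ge0 // ltW.
lra.
Qed.

(** * Finiteness of the resonances *)

Lemma circle_pi_is_zmod_morphism {R : realType} :
  zmod_morphism (@circle_pi R).
Proof. by move=> x y; apply/(addIr (circle_pi y)); rewrite -circle_piD !subrK. Qed.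

HB.instance Definition _ (R : realType) :=
  GRing.isZmodMorphism.Build R (circle R) (@circle_pi R)
    circle_pi_is_zmod_morphism.

(** With [pi y = u], the solutions are the classes of [(y + j) / n] for
[0 <= j < n]. *)
Lemma finite_division {R : realType} (n : nat) (u : circle R) : (0 < n)%N ->
  finite_set [set v : circle R | v *+ n = u].
Proof.
move=> n0; have nR0 : n%:R != 0 :> R by rewrite pnatr_eq0 -lt0n.
have [y yu] := circle_pi_surj u.
apply: (sub_finite_set _
  (finite_image (fun j : nat => circle_pi ((y + j%:R) / n%:R)) (finite_II n))).
move=> v /=; have [x <-] := circle_pi_surj v.
rewrite -raddfMn -yu => /eq_circle_pi[m xym].
have nZ0 : n%:Z != 0 by rewrite -lt0n.
exists `|(m %% n)%Z|%N.
  by rewrite /= -ltz_nat gez0_abs ?modz_ge0 // ltz_pmod.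
apply/eq_circle_pi; exists (- (m %/ n)%Z).
have /(congr1 (fun k : int => k%:~R : R)) := divz_eq m n.
rewrite -[in RHS](gez0_abs (modz_ge0 m nZ0)) intrD intrM intrN -!pmulrn -xym.
set k := `|_|%N; set l := (_ %/ _)%Z => eqm.
apply: (mulIf nR0); rewrite mulrBl divfK // -mulr_natr in eqm *.
lra.
Qed.

Lemma finite_resonances {R : realType} (phi : circle R) (B K : nat) :
  finite_set [set theta : circle R | exists (b : nat) (a : int),
    [/\ (0 < b <= B)%N, (`|a| <= K)%N & theta *+ b = phi *~ a]].
Proof.
have fin : finite_set (\bigcup_(b in `I_B) \bigcup_(a in `I_K.+1)
   ([set theta : circle R | theta *+ b.+1 = phi *~ a%:Z] `|`
    [set theta : circle R | theta *+ b.+1 = phi *~ - a%:Z])).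
  do 2![apply: bigcup_finite => [|? _]; first exact: finite_II].
  by rewrite finite_setU; split; apply: finite_division.
apply: sub_finite_set fin => theta [b [a [/andP[b0 bB] aK tba]]].
exists b.-1; first by rewrite /= prednK.
exists `|a|%N => //; rewrite prednK //.
have [a0|a0] := leP 0 a; [left|right] => /=; rewrite tba.
  by rewrite gez0_abs.
by rewrite ltz0_abs // opprK.
Qed.

(** * Visits to the window *)

Lemma iter_rotation {R : realType} (phi theta : circle R) (n : nat) p :
  iter n (rotation phi theta) p = (p.1 + phi *+ n, p.2 + theta *+ n).
Proof.
elim: n => [|n IHn]; first by rewrite !addr0; case: p.
by rewrite iterS IHn /rotation /= -!addrA !mulrSr.
Qed.

Lemma circle_arc_addr {R : realType} (x t eps : R) (k : int) :
  `|t - k%:~R| < eps -> circle_arc (circle_pi x) eps (circle_pi (x + t)).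
Proof.
move=> tk; exists (t - k%:~R) => /=; first by rewrite in_itv /= -ltr_norml.
by rewrite -circle_piD; apply/eq_circle_pi; exists (- k); rewrite intrN; ring.
Qed.

Theorem lemma29 (R : realType) (c e phi : circle R) (eps : R) :
  0 < eps ->
  finite_set [set theta : circle R |
    ~ (forall d : circle R, exists n : nat,
         (circle_arc c eps `*` circle_arc e eps) (iter n (rotation phi theta) (c, d)))].
Proof.
move=> eps0.
pose M := (Num.truncn (2 / eps)).+1.
have M0 : (0 < M)%N by [].
have Meps : M%:R^-1 < eps / 2.
  by rewrite -[ltRHS]invrK invf_div ltf_pV2 ?posrE ?divr_gt0 // truncnS_gt.
pose K := Num.truncn ((M ^ 3)%:R * (2 / eps)).
apply: sub_finite_set (finite_resonances phi (M ^ 3) K) => theta /=.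
apply: contra_notP => nres d.
have [f phif] := circle_pi_surj phi; have [t thetat] := circle_pi_surj theta.
have [x xc] := circle_pi_surj c; have [y yd] := circle_pi_surj d.
have [z ze] := circle_pi_surj e.
have [[b [a [m [bM aK bt]]]]|dense] := resonance_or_dense_orbit f t M0 Meps.
  case: nres; exists b, a; split => //.
    by rewrite truncn_ge_nat ?natr_absz ?intr_norm // mulr_ge0 ?divr_ge0 ?(ltW eps0).
  rewrite -phif -thetat -raddfMn -raddfMz; apply/eq_circle_pi; exists m.
  by rewrite -mulr_natl bt -mulrzl; ring.
have [n [p [q [fp tq]]]] := dense (z - y).
exists n; rewrite iter_rotation /= -phif -thetat -xc -yd -ze -!raddfMn -!circle_piD.
split => /=; first by apply: (@circle_arc_addr _ _ _ _ p); rewrite -mulr_natl.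
have -> : y + t *+ n = z + (t *+ n - (z - y)) by ring.
by apply: (@circle_arc_addr _ _ _ _ q); rewrite -mulr_natl -addrA -opprD.
Qed.
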